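(* For all integers $k,m,n\ge 0$, the number of partitions $\lambda$ of $n$ with alternating sum $l_a(\lambda)=k$ such that each part appears at most $2m+1$ times equals the number of partitions $\mu$ of $n$ with exactly $k$ odd parts (counted with multiplicity) such that each even part appears at most $m$ times.
   Context: For a partition $\lambda=(\lambda_1\ge\lambda_2\ge\cdots\ge\lambda_r>0)$, the alternating sum is $l_a(\lambda)=\lambda_1-\lambda_2+\lambda_3-\lambda_4+\cdots$. The number of odd parts of $\mu$, counted with multiplicity, is denoted $l_o(\mu)$. *)

(* Defs.v *)
From HB Require Import structures.
From mathcomp Require Import all_boot all_order all_algebra.

Set Implicit Arguments.
Unset Strict Implicit.
Unset Printing Implicit Defensive.

Definition is_part_of (n : nat) (s : seq nat) : bool :=
  [&& sorted geq s, all (ltn 0) s & sumn s == n].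

Record intpartn (n : nat) : Type :=
  IntPartN { parts :> seq nat; _ : is_part_of n parts }.

HB.instance Definition _ n := [isSub for @parts n].
HB.instance Definition _ n := [Countable of intpartn n by <:].

(* [intpartn n] is finite: a partition of n has at most n parts, all of them
   at most n, hence embeds in the finite type [n.-bseq 'I_n.+1]. *)
Section Finiteness.
Variable n : nat.
Implicit Type la : intpartn n.

Lemma sumn_intpartn la : sumn la = n.
Proof. by case: la => s /= /and3P[_ _ /eqP]. Qed.

Lemma intpartn_gt0 la : all (ltn 0) la.
Proof. by case: la => s /= /and3P[]. Qed.

Lemma size_intpartn la : size la <= n.
Proof.
rewrite -{2}(sumn_intpartn la); move: (intpartn_gt0 la).
elim: (parts la) => //= x s IHs /andP[x0 /IHs les].
by rewrite -add1n leq_add.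
Qed.

Lemma intpartn_le la i : i \in parts la -> i <= n.
Proof.
rewrite -{2}(sumn_intpartn la).
elim: (parts la) => //= x s IHs; rewrite in_cons => /predU1P[->|/IHs lei].
  exact: leq_addr.
exact: leq_trans lei (leq_addl _ _).
Qed.

Definition bseq_of_intpartn la : n.-bseq 'I_n.+1 :=
  insub_bseq n [seq inord i | i <- la].

Definition intpartn_of_bseq (b : n.-bseq 'I_n.+1) : option (intpartn n) :=
  insub [seq val i | i <- b].

Lemma bseq_of_intpartnK : pcancel bseq_of_intpartn intpartn_of_bseq.
Proof.
move=> la; rewrite /intpartn_of_bseq /bseq_of_intpartn /insub_bseq.
rewrite insubdK; last by rewrite unfold_in /= size_map size_intpartn.
rewrite -map_comp (_ : map _ _ = val la) ?valK // -[RHS]map_id.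
by apply/eq_in_map => i /intpartn_le lei /=; rewrite inordK.
Qed.

HB.instance Definition _ : isFinite (intpartn n) :=
  PCanIsFinite bseq_of_intpartnK.

End Finiteness.

Definition alt_sum (s : seq nat) : int :=
  (\sum_(i < size s) (-1) ^+ i * (nth 0%N s i)%:Z)%R.

Definition nb_odd_parts (s : seq nat) : nat := count odd s.

(* Main.v *)
(** Removing two equal parts does not change the alternating sum, so a partition
    splits into pairs of equal parts, recorded by a partition [a], and a
    partition into distinct parts with the same alternating sum; the part
    multiplicities are at most [2m+1] iff those of [a] are at most [m].
    Likewise [mu] splits into its even parts, the doubles of the parts of a
    partition [a], and its odd parts.  On each side the number of partitions of
    [n] with a given [a] therefore depends only on [n - 2|a|] (it is the number
    with empty [a] at that weight).  Conjugation exchanges the alternating sum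
    and the number of odd parts, so the totals over all [a] agree, and strong
    induction on [n] makes the counts agree for each [a], the empty one being
    obtained by subtraction.  Summing over the [a] with multiplicities at most
    [m] gives the result. *)

Require Import Defs.
From HB Require Import structures.
From mathcomp Require Import all_boot all_order all_algebra.
From mathcomp Require Import zify.

Set Implicit Arguments.
Unset Strict Implicit.
Unset Printing Implicit Defensive.

Import GRing.Theory.

(** * Weakly decreasing sequences *)

Lemma geq_trans : transitive geq.
Proof. by move=> y x z /= xy yz; exact: leq_trans yz xy. Qed.

Lemma geq_anti : antisymmetric geq.
Proof. by move=> x y; rewrite andbC => /anti_leq. Qed.

Lemma geq_total : total geq.
Proof. by move=> x y; exact: leq_total. Qed.

Lemma sorted_geq_eq (s t : seq nat) :
  sorted geq s -> sorted geq t -> perm_eq s t -> s = t.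
Proof. exact: (sorted_eq geq_trans geq_anti). Qed.

Lemma perm_sort_geq (s : seq nat) : perm_eq (sort geq s) s.
Proof. by rewrite perm_sort. Qed.

Lemma sorted_sort_geq (s : seq nat) : sorted geq (sort geq s).
Proof. exact: sort_sorted geq_total s. Qed.

Lemma perm_sumn (s t : seq nat) : perm_eq s t -> sumn s = sumn t.
Proof. by rewrite !sumnE => st; apply: perm_big. Qed.

Lemma intpartn_sorted n (la : intpartn n) : sorted geq la.
Proof. by case: la => s /= /and3P[]. Qed.

(** * Columns of Young diagrams and the alternating sum *)

Lemma count_ltn_le (x j : nat) (s : seq nat) :
  path geq x s -> x <= j -> count (ltn j) s = 0.
Proof.
rewrite (path_sortedE geq_trans) => /andP[/allP sx _] xj.
apply/eqP; rewrite -leqn0 leqNgt -has_count; apply/hasPn => y /sx /= yx.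
by rewrite -leqNgt (leq_trans yx).
Qed.

(** Either side tests whether the box in row [i], column [j] (from 0) lies in the Young diagram;
    [count (ltn j) s] is a column length. *)
Lemma ltn_nth_count (s : seq nat) (i j : nat) :
  sorted geq s -> (j < nth 0 s i) = (i < count (ltn j) s).
Proof.
elim: s i => [|x s IHs] [|i] //= xs.
  by have [jx|xj] := ltnP j x; rewrite // (count_ltn_le xs xj).
rewrite IHs ?(path_sorted xs) //.
by have [jx|xj] := ltnP j x; rewrite // (count_ltn_le xs xj).
Qed.

Lemma sum_ltn_nat (x N : nat) : x <= N -> \sum_(0 <= j < N) (j < x) = x.
Proof.
elim: N x => [|N IHN] [|x] //= xN; first by rewrite big_geq.
  by rewrite big1.
by rewrite big_nat_recl // IHN.
Qed.

Lemma sum_count_ltn (s : seq nat) (N : nat) :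
  all (geq N) s -> \sum_(0 <= j < N) count (ltn j) s = sumn s.
Proof.
elim: s => [|x s IHs] /=; first by rewrite big1.
by case/andP=> xN sN; rewrite big_split /= sum_ltn_nat ?IHs.
Qed.

Lemma alt_sum_cons (x : nat) (s : seq nat) :
  alt_sum (x :: s) = (x%:Z - alt_sum s)%R.
Proof.
rewrite /alt_sum big_ord_recl /= expr0 mul1r -sumrN; congr (_ + _)%R.
by apply: eq_bigr => i _; rewrite exprS mulN1r mulNr.
Qed.

(* Each column of length [c] of the Young diagram contributes
   [1 - 1 + 1 - ...] ([c] terms), that is [odd c]. *)
Lemma alt_sum_count (s : seq nat) (N : nat) :
  sorted geq s -> all (geq N) s ->
  alt_sum s = (\sum_(0 <= j < N) odd (count (ltn j) s))%:Z%R.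
Proof.
elim: s => [|x s IHs] /=; first by rewrite big1 // /alt_sum big_ord0.
move=> xs /andP[xN sN]; rewrite alt_sum_cons (IHs (path_sorted xs) sN).
suff : \sum_(0 <= j < N) odd ((j < x) + count (ltn j) s) +
       \sum_(0 <= j < N) odd (count (ltn j) s) = x by lia.
(* For [j < x] the two column lengths differ by one, so exactly one is odd; for [j >= x] both
   columns are empty. *)
rewrite -big_split /= -[RHS](sum_ltn_nat xN); apply: eq_bigr => j _.
by have [jx|xj] := ltnP j x; rewrite ?(count_ltn_le xs xj) //= ; case: odd.
Qed.

(** * Conjugation of partitions *)

Definition conj_parts (s : seq nat) : seq nat :=
  mkseq (fun i => count (ltn i) s) (head 0 s).

Lemma sorted_head_max (s : seq nat) : sorted geq s -> all (geq (head 0 s)) s.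
Proof.
by case: s => //= x s; rewrite (path_sortedE geq_trans) leqnn => /andP[].
Qed.

Lemma sumn_conj_parts (s : seq nat) : sorted geq s -> sumn (conj_parts s) = sumn s.
Proof.
move=> ss; rewrite -(sum_count_ltn (sorted_head_max ss)) sumnE big_map.
by rewrite /index_iota subn0.
Qed.

Lemma nb_odd_conj_parts (s : seq nat) :
  sorted geq s -> (nb_odd_parts (conj_parts s))%:Z%R = alt_sum s.
Proof.
move=> ss; rewrite (alt_sum_count ss (sorted_head_max ss)).
by rewrite /nb_odd_parts count_map -sumn_count sumnE big_map /index_iota subn0.
Qed.

Lemma conj_parts_is_part n (la : intpartn n) : is_part_of n (conj_parts la).
Proof.
have ss := intpartn_sorted la; apply/and3P; split.
- rewrite /conj_parts /mkseq; apply: homo_sorted (iota_ltn_sorted 0 _).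
  by move=> i j /= ij; apply: sub_count => x /=; apply: ltn_trans.
- apply/allP => _ /mapP[i + ->]; rewrite mem_iota add0n -nth0 /=.
  by rewrite (ltn_nth_count _ _ ss).
- by rewrite sumn_conj_parts // sumn_intpartn.
Qed.

Definition conj_intpartn n (la : intpartn n) : intpartn n :=
  IntPartN (conj_parts_is_part la).

(** The columns of the conjugate are the rows of [s]; beyond the last row both sides are 0. *)
Lemma count_ltn_conj_parts (s : seq nat) i :
  sorted geq s -> count (ltn i) (conj_parts s) = nth 0 s i.
Proof.
move=> ss; rewrite count_map -sumn_count sumnE big_map.
under eq_bigr do rewrite /= -(ltn_nth_count _ _ ss).
have := @sum_ltn_nat (nth 0 s i) (head 0 s); rewrite /index_iota subn0; apply.
have [lti|gei] := ltnP i (size s); last by rewrite nth_default.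
by have /allP/(_ _ (mem_nth 0 lti)) := sorted_head_max ss.
Qed.

Lemma conj_intpartnK n : involutive (@conj_intpartn n).
Proof.
move=> la; apply: val_inj; have ss := intpartn_sorted la.
have := intpartn_gt0 la; rewrite /= {1}/conj_parts => la0.
under eq_mkseq do rewrite count_ltn_conj_parts //.
rewrite -[RHS](mkseq_nth 0); congr mkseq.
(* It remains to match the lengths: column 0 meets every row because all parts are positive. *)
case: (parts la) la0 => //= x s /andP[].
case: x => //= x _ s0; congr _.+1.
by apply/eqP; rewrite -all_count.
Qed.

Lemma card_alt_sum_nb_odd (k n : nat) :
  #|[set la : intpartn n | alt_sum la == k%:Z%R]| =
  #|[set mu : intpartn n | nb_odd_parts mu == k]|.
Proof.
rewrite -(card_imset _ (inv_inj (@conj_intpartnK n))); apply: eq_card => mu.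
rewrite !inE -{1}[mu]conj_intpartnK (mem_imset _ _ (inv_inj (@conj_intpartnK n))).
rewrite inE -nb_odd_conj_parts ?intpartn_sorted //.
by rewrite -{2}[mu]conj_intpartnK.
Qed.

(** * Counting by fibers *)

Lemma card_fibers (T : finType) (E : eqType) (f : T -> E) (P : pred T)
    (Q : pred E) (s : seq E) :
  uniq s -> {subset codom f <= s} ->
  #|[set x | P x && Q (f x)]| =
  \sum_(e <- s | Q e) #|[set x | P x && (f x == e)]|.
Proof.
move=> us fs; under eq_bigr do rewrite -sum1_card big_mkcond /=.
rewrite exchange_big /= -sum1_card big_mkcond /=; apply: eq_bigr => x _.
rewrite inE big_mkcond (bigD1_seq (f x)) ?fs ?codom_f //= big1 ?addn0.
  by rewrite inE eqxx andbT; case: (P x); case: Q.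
by move=> e /negPf; rewrite eq_sym inE => ->; rewrite andbF; case: Q.
Qed.

Section EqualFibers.
Variables (T T' : finType) (E : eqType) (f : T -> E) (g : T' -> E).
Variables (P : pred T) (P' : pred T').

Lemma eq_card_fibers (Q : pred E) :
  (forall e, Q e ->
     #|[set x | P x && (f x == e)]| = #|[set y | P' y && (g y == e)]|) ->
  #|[set x | P x && Q (f x)]| = #|[set y | P' y && Q (g y)]|.
Proof.
(* [E] may be infinite, so both sums range over one finite list containing the values of [f] and
   [g]. *)
move=> fg; pose s := undup (codom f ++ codom g).
rewrite (@card_fibers _ _ f P Q s) ?undup_uniq //; last first.
  by move=> e; rewrite mem_undup mem_cat => ->.
rewrite (@card_fibers _ _ g P' Q s) ?undup_uniq //; last first.
  by move=> e; rewrite mem_undup mem_cat orbC => ->.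
exact: eq_bigr.
Qed.

(** Subtracting the elements outside the fiber over [e0] from equal totals leaves equal numbers. *)
Lemma eq_card_last_fiber (e0 : E) : #|[set x | P x]| = #|[set y | P' y]| ->
  (forall e, e != e0 ->
     #|[set x | P x && (f x == e)]| = #|[set y | P' y && (g y == e)]|) ->
  #|[set x | P x && (f x == e0)]| = #|[set y | P' y && (g y == e0)]|.
Proof.
have split (U : finType) (h : U -> E) (R : pred U) :
    #|[set x | R x]| = #|[set x | R x && (h x == e0)]|
                     + #|[set x | R x && (h x != e0)]|.
  rewrite -(cardsID [set x | h x == e0]); congr (_ + _).
    by apply: eq_card => x; rewrite !inE.
  by apply: eq_card => x; rewrite !inE andbC.
by move=> + /eq_card_fibers fg; rewrite (split _ f) (split _ g) fg => /addIn.
Qed.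
End EqualFibers.

(** * Inserting a fixed multiset of parts *)

Lemma perm_cat_of_count (s t : seq nat) :
  (forall i, count_mem i s <= count_mem i t) -> {r | perm_eq t (r ++ s)}.
Proof.
move=> st.
have /sigW[u /andP[ut su]] : exists u, subseq u t && perm_eq s u.
  have /count_subseqP[u ut su] : forall x, count_mem x s <= count_mem x t by [].
  by exists u; rewrite ut.
have [r tr] := perm_to_subseq ut.
by exists r; rewrite (perm_trans tr) // perm_catC perm_cat2l perm_sym.
Qed.

Lemma add_parts_is_part n (b : seq nat) (b0 : all (ltn 0) b) (la : intpartn n) :
  is_part_of (n + sumn b) (sort geq (la ++ b)).
Proof.
apply/and3P; split; first exact: sorted_sort_geq.
  by rewrite (perm_all _ (perm_sort_geq _)) all_cat intpartn_gt0.
by rewrite (perm_sumn (perm_sort_geq _)) sumn_cat sumn_intpartn.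
Qed.

Definition add_parts n (b : seq nat) (b0 : all (ltn 0) b) (la : intpartn n) :
  intpartn (n + sumn b) := IntPartN (add_parts_is_part b0 la).

Lemma add_parts_inj n (b : seq nat) (b0 : all (ltn 0) b) :
  injective (@add_parts n b b0).
Proof.
move=> la mu /(congr1 val) /= eq_lm; apply: val_inj.
apply: sorted_geq_eq; rewrite ?intpartn_sorted //.
rewrite -(perm_cat2r b) -(perm_sort geq) /= perm_sym -(perm_sort geq) perm_sym.
by rewrite eq_lm.
Qed.

(** Inserting [b] is injective; it reaches every partition satisfying [Q], since such a partition
    contains [b] as a multiset and [b] can be removed. *)
Lemma card_add_parts n (b : seq nat) (P Q : pred (seq nat)) :
  all (ltn 0) b ->
  (forall s, sorted geq s -> Q (sort geq (s ++ b)) = P s) ->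
  (forall t, Q t -> forall i, count_mem i b <= count_mem i t) ->
  #|[set la : intpartn (n + sumn b) | Q la]| = #|[set la : intpartn n | P la]|.
Proof.
move=> b0 QP Qb; rewrite -(card_imset _ (@add_parts_inj n b b0)).
apply: eq_card => mu; rewrite inE; apply/idP/imsetP => [Qmu|[la]]; last first.
  by rewrite inE => Pla ->; rewrite QP ?intpartn_sorted.
have [r mur] := perm_cat_of_count (Qb _ Qmu).
have part_r : is_part_of n (sort geq r).
  have := perm_all (ltn 0) mur; rewrite intpartn_gt0 all_cat => /esym/andP[r0 _].
  have := perm_sumn mur; rewrite sumn_intpartn sumn_cat => /addIn ->.
  rewrite /is_part_of sorted_sort_geq (perm_all _ (perm_sort_geq _)) r0.
  by rewrite (perm_sumn (perm_sort_geq _)) eqxx.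
have mu_def : mu = add_parts b0 (IntPartN part_r).
  apply: val_inj; apply: sorted_geq_eq; rewrite ?intpartn_sorted //=.
  by rewrite (perm_trans mur) // perm_sym perm_sort perm_cat2r perm_sort.
exists (IntPartN part_r) => //; rewrite inE -QP ?sorted_sort_geq //.
by rewrite {1}mu_def in Qmu.
Qed.

(** * The recorded partitions and their fibers *)

Definition pairs_of (s : seq nat) : seq nat :=
  sort geq (flatten [seq nseq (count_mem x s)./2 x | x <- undup s]).

Lemma count_mem_pairs_of (s : seq nat) i :
  count_mem i (pairs_of s) = (count_mem i s)./2.
Proof.
rewrite (permP (perm_sort_geq _)) count_flatten sumnE !big_map.
under eq_bigr do rewrite count_nseq /=.
have [si|/count_memPn nsi] := boolP (i \in s).
  rewrite (bigD1_seq i) ?mem_undup ?undup_uniq //= eqxx mul1n big1 ?addn0 //.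
  by move=> j /negPf ->.
rewrite nsi big_seq big1 // => j; rewrite mem_undup => js.
by case: eqP => // ji; move/count_memPn: nsi; rewrite -ji js.
Qed.

Definition even_halves (s : seq nat) : seq nat :=
  sort geq [seq i./2 | i <- s & ~~ odd i].

Lemma count_mem_even_halves (s : seq nat) i :
  count_mem i (even_halves s) = count_mem i.*2 s.
Proof.
rewrite (permP (perm_sort_geq _)) count_map count_filter.
by apply: eq_count => x /=; lia.
Qed.


(* [h s] is the partition recorded by [s], and [d a] the parts that record [a]:
   pairs of equal parts for alternating sums, even parts for odd parts. *)
Section Fibers.
Variables (S : pred (seq nat)) (h d : seq nat -> seq nat).
Hypothesis sorted_h : forall s, sorted geq (h s).
Hypothesis h_gt0 : forall s, all (ltn 0) s -> all (ltn 0) (h s).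
Hypothesis sumn_d : forall a, sumn (d a) = (sumn a).*2.
Hypothesis d_gt0 : forall a, all (ltn 0) a -> all (ltn 0) (d a).
Hypothesis h_add : forall s a, perm_eq (h (sort geq (s ++ d a))) (h s ++ a).
Hypothesis S_add : forall s a, sorted geq s -> S (sort geq (s ++ d a)) = S s.
Hypothesis count_d_h : forall t i, count_mem i (d (h t)) <= count_mem i t.

Lemma sumn_fiber_le t : (sumn (h t)).*2 <= sumn t.
Proof.
have [r tr] := perm_cat_of_count (count_d_h t).
by rewrite (perm_sumn tr) sumn_cat sumn_d leq_addl.
Qed.

Lemma card_fiber n a :
  #|[set la : intpartn n | S la && (h la == a)]| =
  if [&& sorted geq a, all (ltn 0) a & (sumn a).*2 <= n]
  then #|[set la : intpartn (n - (sumn a).*2) | S la && (h la == [::])]| else 0.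
Proof.
case: ifPn => [/and3P[sa a0 an]|na]; last first.
  apply/eqP; rewrite cards_eq0; apply/eqP/setP => la; rewrite !inE.
  apply: contraNF na => /andP[_ /eqP <-]; rewrite sorted_h h_gt0 ?intpartn_gt0 //=.
  by rewrite -[X in _ <= X](sumn_intpartn la) sumn_fiber_le.
rewrite -sumn_d in an *; have := subnK an.
(* Replacing [n] by [p + sumn (d a)] gives the dependent type [intpartn n] the form that
   [card_add_parts] expects. *)
move: (n - _) => p np; case: n / np {an}.
apply: (@card_add_parts p (d a) (fun s => S s && (h s == [::]))
                                (fun s => S s && (h s == a))); first exact: d_gt0.
(* By [h_add], comparing sizes forces [h s] to be empty; conversely, two sorted permutations of each
   other are equal. *)
- move=> s ss; rewrite S_add //; congr (_ && _); apply/eqP/eqP => hs.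
    have := perm_size (h_add s a); rewrite hs size_cat => sz.
    by apply/nilP; rewrite /nilp; lia.
  by apply: sorted_geq_eq => //; have := h_add s a; rewrite hs.
- by move=> t /andP[_ /eqP <-] i; exact: count_d_h.
Qed.
End Fibers.

(** * Pairs of equal parts *)

Lemma sumn_pairs (a : seq nat) : sumn (a ++ a) = (sumn a).*2.
Proof. by rewrite sumn_cat addnn. Qed.

Lemma pairs_of_gt0 (s : seq nat) : all (ltn 0) s -> all (ltn 0) (pairs_of s).
Proof.
move=> /allP s0; apply/allP => i; rewrite -has_pred1 has_count.
rewrite count_mem_pairs_of => ci; apply: s0.
by rewrite -has_pred1 has_count; lia.
Qed.

Lemma pairs_of_add (s a : seq nat) :
  perm_eq (pairs_of (sort geq (s ++ (a ++ a)))) (pairs_of s ++ a).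
Proof.
apply/allP => i _ /=; rewrite count_cat !count_mem_pairs_of.
by rewrite (permP (perm_sort_geq _)) !count_cat addnn halfD odd_double andbF doubleK.
Qed.

(** Each column grows by an even length, so the number of odd columns is unchanged. *)
Lemma alt_sum_add_pairs (s a : seq nat) :
  sorted geq s -> alt_sum (sort geq (s ++ (a ++ a))) = alt_sum s.
Proof.
move=> ss; pose N := sumn (s ++ a).
have bound t : {subset t <= s ++ a} -> all (geq N) t.
  move=> ts; apply/allP => x /ts; rewrite /N; elim: (s ++ a) => //= y u IHu.
  by rewrite inE => /predU1P[->|/IHu /=]; lia.
rewrite (@alt_sum_count _ N) ?sorted_sort_geq //; last first.
  by apply: bound => x; rewrite mem_sort !mem_cat orbb.
rewrite (@alt_sum_count s N) //; last first.
  by apply: bound => x; rewrite mem_cat => ->.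
congr Posz; apply: eq_bigr => j _.
by rewrite (permP (perm_sort_geq _)) !count_cat addnn oddD odd_double addbF.
Qed.

(** * Even parts *)

Lemma sumn_doubles (a : seq nat) : sumn (map double a) = (sumn a).*2.
Proof. by elim: a => //= x a ->; rewrite doubleD. Qed.

Lemma even_halves_gt0 (s : seq nat) :
  all (ltn 0) s -> all (ltn 0) (even_halves s).
Proof.
move=> /allP s0; rewrite (perm_all _ (perm_sort_geq _)).
apply/allP => _ /mapP[x + ->]; rewrite mem_filter => /andP[ox /s0 /=].
by lia.
Qed.

Lemma count_mem_doubles (a : seq nat) i :
  count_mem i (map double a) = if odd i then 0 else count_mem i./2 a.
Proof.
rewrite count_map; case: ifP => oi; last by apply: eq_count => x /=; lia.
by rewrite -[RHS](count_pred0 a); apply: eq_count => x /=; lia.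
Qed.

Lemma even_halves_add (s a : seq nat) :
  perm_eq (even_halves (sort geq (s ++ map double a))) (even_halves s ++ a).
Proof.
apply/allP => i _ /=; rewrite count_cat !count_mem_even_halves.
rewrite (permP (perm_sort_geq _)) count_cat count_mem_doubles odd_double.
by rewrite doubleK.
Qed.

Lemma nb_odd_add_doubles (s a : seq nat) :
  nb_odd_parts (sort geq (s ++ map double a)) = nb_odd_parts s.
Proof.
rewrite /nb_odd_parts (permP (perm_sort_geq _)) count_cat count_map.
rewrite [X in _ + X](@eq_count _ _ pred0) ?count_pred0 ?addn0 // => x /=.
by rewrite odd_double.
Qed.

(** * Comparison of the two families of fibers *)

Lemma card_pairs_fiber k n a :
  #|[set la : intpartn n | (alt_sum la == k) && (pairs_of la == a)]| =
  if [&& sorted geq a, all (ltn 0) a & (sumn a).*2 <= n]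
  then #|[set la : intpartn (n - (sumn a).*2) |
            (alt_sum la == k) && (pairs_of la == [::])]| else 0.
Proof.
apply: (@card_fiber (fun s => alt_sum s == k) pairs_of (fun a => a ++ a)).
- by move=> s; exact: sorted_sort_geq.
- exact: pairs_of_gt0.
- exact: sumn_pairs.
- by move=> b b0; rewrite all_cat b0.
- exact: pairs_of_add.
- by move=> s b ss; rewrite alt_sum_add_pairs.
- by move=> t i; rewrite count_cat count_mem_pairs_of; lia.
Qed.

Lemma card_even_halves_fiber k n a :
  #|[set mu : intpartn n | (nb_odd_parts mu == k) && (even_halves mu == a)]| =
  if [&& sorted geq a, all (ltn 0) a & (sumn a).*2 <= n]
  then #|[set mu : intpartn (n - (sumn a).*2) |
            (nb_odd_parts mu == k) && (even_halves mu == [::])]| else 0.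
Proof.
apply: (@card_fiber (fun s => nb_odd_parts s == k) even_halves (map double)).
- by move=> s; exact: sorted_sort_geq.
- exact: even_halves_gt0.
- exact: sumn_doubles.
- by move=> b /allP b0; apply/allP => _ /mapP[x /b0 /= x0 ->]; rewrite double_gt0.
- exact: even_halves_add.
- by move=> s b ss; rewrite nb_odd_add_doubles.
- move=> t i; rewrite count_mem_doubles count_mem_even_halves.
  by case: ifP => // /negbT; rewrite -dvdn2 -muln2 => ei; rewrite -[_./2]divn2 divnK.
Qed.

Lemma eq_card_pairs_even_halves k n a :
  #|[set la : intpartn n | (alt_sum la == k%:Z%R) && (pairs_of la == a)]| =
  #|[set mu : intpartn n | (nb_odd_parts mu == k) && (even_halves mu == a)]|.
Proof.
elim/ltn_ind: n a => n IHn.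
have fibers a : a != [::] ->
  #|[set la : intpartn n | (alt_sum la == k%:Z%R) && (pairs_of la == a)]| =
  #|[set mu : intpartn n | (nb_odd_parts mu == k) && (even_halves mu == a)]|.
  move=> an; rewrite card_pairs_fiber card_even_halves_fiber.
  (* A nonempty [a] with positive parts has positive sum, so the weight strictly drops. *)
  case: ifP => // /and3P[_ a0 le_an]; apply: IHn.
  by case: a a0 le_an an => //= x a /andP[x0 _]; lia.
move=> a; have [->|] := eqVneq a [::]; last exact: fibers.
(* The totals agree by conjugation, which leaves the fiber over [[::]]. *)
exact: (@eq_card_last_fiber _ _ _ (pairs_of \o @parts n)
  (even_halves \o @parts n) (fun la => alt_sum la == k%:Z%R)
  (fun mu => nb_odd_parts mu == k)) (card_alt_sum_nb_odd k n) fibers.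
Qed.

(** For a multiplicity [c], [c./2 <= m] iff [c <= 2 * m + 1]; parts of multiplicity one vanish from
    [pairs_of s] but meet the bound anyway. *)
Lemma all_count_pairs_of m (s : seq nat) :
  all (fun i => count_mem i (pairs_of s) <= m) (pairs_of s) =
  all (fun i => count_mem i s <= 2 * m + 1) s.
Proof.
by apply/allP/allP => H i; rewrite -has_pred1 has_count; move: (H i);
   rewrite -has_pred1 has_count count_mem_pairs_of; lia.
Qed.

Lemma all_count_even_halves m (s : seq nat) :
  all (fun i => count_mem i (even_halves s) <= m) (even_halves s) =
  all (fun i => ~~ odd i ==> (count_mem i s <= m)) s.
Proof.
apply/allP/allP => H i.
  move=> si; apply/implyP => oi; have := H i./2.
  rewrite count_mem_even_halves even_halfK //; apply.
  rewrite -has_pred1 has_count count_mem_even_halves even_halfK //.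
  by rewrite -has_count has_pred1.
rewrite -has_pred1 has_count count_mem_even_halves -has_count has_pred1.
by move=> /H; rewrite odd_double.
Qed.

Theorem theorem3p1 (k m n : nat) :
  #|[set la : intpartn n |
      (alt_sum la == k%:Z%R) &&
      all (fun i : nat => count_mem i la <= 2 * m + 1) la]|
  = #|[set mu : intpartn n |
      (nb_odd_parts mu == k) &&
      all (fun i : nat => ~~ odd i ==> (count_mem i mu <= m)) mu]|.
Proof.
(* Both multiplicity conditions become this one condition on the recorded partition. *)
pose Q (a : seq nat) := all (fun i => count_mem i a <= m) a.
under eq_finset do rewrite -all_count_pairs_of.
under [in RHS]eq_finset do rewrite -all_count_even_halves.
exact: (@eq_card_fibers _ _ _ (pairs_of \o @parts n)
  (even_halves \o @parts n) (fun la => alt_sum la == k%:Z%R)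
  (fun mu => nb_odd_parts mu == k) Q) (fun a _ => eq_card_pairs_even_halves k n a).
Qed.
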